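(* Let $d \ge 2$ and let $G$ be a simple $d$-uniform hypergraph on $n$ vertices, where $d$ divides $n$. Then the number $\varphi(G)$ of 1-factors of $G$ satisfies $$\varphi(G) \leq \left(\frac{\operatorname{per} M(G)}{\mu(n,d)} \right)^{1/d},$$ where $M(G)$ is the adjacency matrix of $G$ and $\mu(n,2)=1$, $\mu(n,3)=\left(\frac{2^{3/2}}{3}\right)^n$, and $\mu(n,d)=\left(\frac{d!^{2}}{d^{d}\, d!^{1/d}}\right)^n$ for $d\ge 4$.
   Context: A $d$-uniform hypergraph $G=(X,W)$ on $n$ vertices has a vertex set $X=\{x_1,\dots,x_n\}$ and hyperedge set $W$, each hyperedge being a set of $d$ vertices. It is simple if it has no multiple hyperedges. A 1-factor of $G$ is a set of hyperedges such that every vertex is incident to exactly one hyperedge of the set; $\varphi(G)$ is the number of 1-factors of $G$. A $d$-dimensional matrix of order $n$ is an array $A=(a_{\alpha})$ of reals indexed by $\alpha=(\alpha_1,\dots,\alpha_d)\in\{1,\dots,n\}^d$. Its permanent is $\operatorname{per} A=\sum_{\sigma_1,\dots,\sigma_{d-1}\in S_n}\prod_{i=1}^n a_{i,\sigma_1(i),\dots,\sigma_{d-1}(i)}$. The adjacency matrix $M(G)$ of a $d$-uniform hypergraph $G$ on $n$ vertices is the $d$-dimensional $(0,1)$-matrix of order $n$ with $m_{\alpha_1,\dots,\alpha_d}=1$ if and only if $\{x_{\alpha_1},\dots,x_{\alpha_d}\}$ is a hyperedge of $G$ (in particular the indices are then pairwise distinct). *)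

(* Defs.v *)
From HB Require Import structures.
From mathcomp Require Import all_boot all_order all_algebra all_fingroup.
From mathcomp Require Import reals exp.

Set Implicit Arguments.
Unset Strict Implicit.
Unset Printing Implicit Defensive.

Import Order.TTheory GRing.Theory Num.Theory.

Local Open Scope ring_scope.

(* A simple hypergraph on the vertex set X is its hyperedge set
   W : {set {set X}}; being a set, W has no multiple hyperedges. *)

Definition uniform (X : finType) (d : nat) (W : {set {set X}}) : bool :=
  [forall e in W, #|e| == d].

Definition is_factor1 (X : finType) (W F : {set {set X}}) : bool :=
  (F \subset W) && [forall v : X, #|[set e in F | v \in e]| == 1%N].

Definition num_factor1 (X : finType) (W : {set {set X}}) : nat :=
  #|[set F : {set {set X}} | is_factor1 W F]|.

Definition multimatrix (R : Type) (d n : nat) : Type := d.-tuple 'I_n -> R.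

(* The permutations sigma_1, ..., sigma_(d-1) are indexed by 'I_(d-1).  The
   value for d = 0, where the formula makes no sense, is arbitrary. *)
Definition per (R : pzRingType) (d n : nat) : multimatrix R d n -> R :=
  match d return multimatrix R d n -> R with
  | 0 => fun=> 0
  | k.+1 => fun A =>
      \sum_(sigma : {ffun 'I_k -> {perm 'I_n}})
        \prod_(i < n) A [tuple of i :: [tuple sigma j i | j < k]]
  end.

(* x enumerates the vertices.  When W is d-uniform, an entry equal to 1 forces
   the d indices to be pairwise distinct, as the set below then has size d. *)
Definition adjacency (R : pzRingType) (X : finType) (d n : nat)
    (x : 'I_n -> X) (W : {set {set X}}) : multimatrix R d n :=
  fun alpha => ([set x i | i in alpha] \in W)%:R.
Arguments adjacency R {X} d {n} x W _.

(* Only meant for 2 <= d. *)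
Definition mu (R : realType) (n d : nat) : R :=
  match d with
  | 2 => 1
  | 3 => (2 `^ (3 / 2) / 3) ^+ n
  | _ => (d`!%:R ^+ 2 / (d%:R ^+ d * d`!%:R `^ (1 / d%:R))) ^+ n
  end.

(* Main.v *)
Require Import Defs.
From mathcomp Require Import all_boot all_order all_algebra all_fingroup.
From mathcomp Require Import reals exp ring lra.

Import Order.TTheory GRing.Theory Num.Theory.

Local Open Scope ring_scope.

(** The [d]-tuples of 1-factors of [W] are compared with the nonzero diagonals of
    the adjacency matrix through the [d]-regular hypergraphs that they cover.
    Give the [n] edges, counted with multiplicity, of such a hypergraph [h]
    labels in [X].  A [d]-tuple of 1-factors is a colouring of the labels with
    [d] colours in which each class is a 1-factor ([factor_tuples_le]); a
    diagonal is a way of ordering all the edges so that each of the [d]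
    positions displays every vertex exactly once ([perm_tuples_le]).  Both
    counts carry the same factor [n!] for the labelling, so it suffices to show
    for each single [h] that the number of colourings times [mu] is at most the
    number of orderings ([factor_colorings_le]).

    An ordering is a decomposition of the [d]-regular bipartite incidence graph
    of [h] into [d] perfect matchings.  The number of perfect matchings of a
    [k]-regular bipartite graph on [m + m] vertices is at least
    [k ^ m * g ^ (m - 1)], where [g = ((k - 1) / k) ^ (k - 1)]
    ([regular_msum_ge]).  This is the bound of Schrijver and Gurvits, proved by
    eliminating one column at a time from a product of linear forms.  What
    makes an elimination cheap is usually a real-rootedness statement; here it
    is replaced by the monotonicity of ratios of matching sums
    ([msum_ratio_le]), which follows by induction from the expansions along a
    row and along a column.  Removing matchings for [k = d, d - 1, ..., 1] gives
    at least [(d!^2 / d^d) ^ n] orderings, since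
    [d!^2 / d^d] is the product of the numbers [k * g] ([prod_gurvits_growth]).

    A colouring is proper around each vertex, so colouring greedily gives at
    most [s!] choices each time the last [s] labels around a vertex are
    coloured.  If [rho] satisfies [s! <= rho ^ s] for [s < d], there are at most
    [rho ^ n] colourings, except that the first star of every connected component
    costs [d!] instead of [rho ^ d].  This excess is absorbed, component by
    component, by the saved factor [g] in the bound on matchings, as soon as
    [d! * g <= rho ^ d] ([partial_colorings_le_matchings]).  The choices [1] for
    [d = 2], the square root of [2] for [d = 3] and the [d]-th root of [d!] for
    [d >= 4] then make [d!^2 / (d^d * rho)] the [n]-th root of [mu] ([muE]). *)

(** * Sums over partial matchings *)

Section MatchingSum.
Variables (R : realFieldType) (V L : finType) (a : V -> L -> R).
Hypothesis a_ge0 : forall i c, 0 <= a i c.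
Implicit Types (S T : {set V}) (C : seq L) (w u : V -> R).

(** The permanent of the square matrix formed by the columns [a _ c], [c] in [C],
    followed by [#|S| - size C] copies of the column [w], divided by
    [(#|S| - size C)!], when [size C <= #|S|]: the rows of [S] left unmatched by
    the columns of [C] are weighted by [w].  It is the polynomial obtained from
    the product over [S] of the row forms by differentiating once in each
    variable of [C]; letting [w] be a free vector, rather than the row sums over
    the remaining columns, is what allows inductions that move one entry of [w]
    at a time. *)
Fixpoint msum C S w : R :=
  if C is c :: C' then \sum_(i in S) a i c * msum C' (S :\ i) w
  else \prod_(i in S) w i.

Lemma msum_ge0 C S w : {in S, forall i, 0 <= w i} -> 0 <= msum C S w.
Proof.
elim: C S => [|c C IH] S w_ge0 /=; first exact: prodr_ge0.
apply: sumr_ge0 => i Si; apply: mulr_ge0 => //; apply: IH => j /setD1P[_].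
exact: w_ge0.
Qed.

Lemma eq_msum C S w w' : {in S, w =1 w'} -> msum C S w = msum C S w'.
Proof.
elim: C S => [|c C IH] S eqw /=; first exact: eq_bigr.
by apply: eq_bigr => i Si; rewrite (IH (S :\ i)) // => j /setD1P[_ /eqw].
Qed.

(** When the columns use up all the rows, nothing is left to be weighted. *)
Lemma eq_msum_card C S w w' : (#|S| <= size C)%N -> msum C S w = msum C S w'.
Proof.
elim: C S => [|c C IH] S /=.
  by rewrite leqn0 cards_eq0 => /eqP->; rewrite !big_set0.
move=> leSC; apply: eq_bigr => i Si; congr (_ * _); apply: IH.
by move: leSC; rewrite (cardsD1 i) Si.
Qed.

Lemma msum_eq0 C S w w' :
  {in S, forall i, 0 < w i} -> msum C S w = 0 -> msum C S w' = 0.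
Proof.
elim: C S => [|c C IH] S w_gt0 /=.
  move=> P0; have : 0 < \prod_(i in S) w i by apply: prodr_gt0.
  by rewrite P0 ltxx.
have w_gt0' i : {in S :\ i, forall j, 0 < w j} by move=> j /setD1P[_ /w_gt0].
move=> P0; apply: big1 => i Si.
have := psumr_eq0P (fun i (_ : i \in S) => mulr_ge0 (a_ge0 i c)
  (msum_ge0 C _ _ (fun j Sj => ltW (w_gt0' i j Sj)))) P0.
move=> /(_ i Si) /eqP; rewrite mulf_eq0 => /orP[/eqP->|/eqP PC0].
  by rewrite mul0r.
by rewrite (IH _ (w_gt0' i)) ?mulr0.
Qed.

(** Ordered pairs of distinct rows can be drawn in either order. *)
Lemma exchange_setD1 S (F : V -> V -> R) :
  \sum_(i in S) \sum_(k in S :\ i) F i k =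
  \sum_(k in S) \sum_(i in S :\ k) F i k.
Proof.
rewrite !pair_big_dep [RHS](reindex_inj (h := fun p => (p.2, p.1))) /=; last first.
  by move=> [? ?] [? ?] [-> ->].
apply: eq_bigl => -[i k] /=; rewrite !inE eq_sym.
by case: (i \in S); case: (k \in S); rewrite ?andbF ?andbT.
Qed.

(** The columns play symmetric roles although the recursion treats them in
    order: drawing rows for the first column and for [c] commutes. *)
Lemma msum_col C S w c : c \in C ->
  msum C S w = \sum_(i in S) a i c * msum (rem c C) (S :\ i) w.
Proof.
elim: C S => [//|c0 C IH] S; rewrite inE /=.
case: (eqVneq c c0) => [->|cNc0] //= cC.
under eq_bigr => i _ do rewrite IH // big_distrr.
rewrite exchange_setD1; apply: eq_bigr => k Sk.
rewrite big_distrr; apply: eq_bigr => i _ /=.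
by rewrite setDDl setUC -setDDl mulrCA.
Qed.

(** A row is either unmatched, contributing [w i], or matched to one column. *)
Lemma msum_row C S w i : uniq C -> i \in S ->
  msum C S w = w i * msum C (S :\ i) w
    + \sum_(c <- C) a i c * msum (rem c C) (S :\ i) w.
Proof.
elim: C S => [|c0 C IH] S /=; first by move=> _ Si; rewrite big_nil addr0 (big_setD1 i).
case/andP=> c0NC uC Si; rewrite big_cons eqxx (big_setD1 i) //=.
rewrite addrCA; congr (_ + _).
have -> : \sum_(c <- C) a i c
      * msum (if c0 == c then C else c0 :: rem c C) (S :\ i) w =
    \sum_(c <- C) \sum_(k in S :\ i)
      a k c0 * (a i c * msum (rem c C) (S :\ k :\ i) w).
  rewrite big_seq [RHS]big_seq; apply: eq_bigr => c cC.
  case: eqP => [eqc|_]; first by rewrite eqc cC in c0NC.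
  rewrite /= big_distrr; apply: eq_bigr => k _ /=.
  by rewrite mulrCA !setDDl setUC.
rewrite exchange_big /= big_distrr -big_split /=.
apply: eq_bigr => k /setD1P[kNi Sk].
rewrite (IH (S :\ k)) ?inE 1?eq_sym ?kNi // mulrDr mulrCA; congr (_ + _).
  by rewrite !setDDl setUC.
by rewrite big_distrr.
Qed.

Lemma msum_affine C S w w' i : uniq C -> i \in S -> {in S :\ i, w =1 w'} ->
  msum C S w' = msum C S w + (w' i - w i) * msum C (S :\ i) w.
Proof.
move=> uC Si eqw; rewrite !(msum_row C S _ i) // (eq_msum _ _ _ _ eqw).
under [X in _ = _ + X + _]eq_bigr => c _ do rewrite (eq_msum _ _ _ _ eqw).
by ring.
Qed.

(** The ratio of [msum C S] to [msum C (S :\ i)] is a nondecreasing function of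
    [w].  Expanding along row [i] turns this ratio into [w i] plus a nonnegative
    combination of ratios [msum (rem c C) T / msum C T] with [T = S :\ i], and
    expanding along column [c] turns the inverse of each of those into a
    combination of inverses of ratios of the first kind, for one row less.  So
    monotonicity passes through the two expansions.  This is the negative
    correlation that real stability would provide; written without division,
    it also covers vanishing sums. *)
Lemma msum_ratio_le C S w w' i : uniq C -> i \in S ->
    {in S, forall j, 0 <= w j <= w' j} ->
  msum C S w * msum C (S :\ i) w' <= msum C S w' * msum C (S :\ i) w.
Proof.
move: {2}#|S| (erefl #|S|) => m; elim: m => [|m IH] in C S i *.
  by move/eqP; rewrite cards_eq0 => /eqP->; rewrite inE.
move=> cardS uC Si lew.
have lew' : {in S :\ i, forall j, 0 <= w j <= w' j}.
  by move=> j /setD1P[_ /lew].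
have cardS' : #|S :\ i| = m by apply/eqP; rewrite -eqSS -cardS (cardsD1 i S) Si.
have w_ge0 : {in S :\ i, forall j, 0 <= w j} by move=> j /lew'/andP[].
have w'_ge0 : {in S :\ i, forall j, 0 <= w' j}.
  by move=> j /lew'/andP[] /le_trans; apply.
rewrite !(msum_row C S _ i) // !mulrDl; apply: lerD.
  rewrite mulrAC -!mulrA; have /andP[_ ?] := lew i Si.
  by apply: ler_wpM2r => //; rewrite mulr_ge0 ?msum_ge0.
rewrite !big_distrl /= big_seq [leRHS]big_seq; apply: ler_sum => c cC.
rewrite -!mulrA; apply: ler_wpM2l => //.
rewrite !(msum_col C (S :\ i) _ c) // !big_distrr /=.
apply: ler_sum => k Sk; rewrite mulrCA [leRHS]mulrCA.
apply: ler_wpM2l => //; apply: IH => //; exact: rem_uniq.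
Qed.

(** Raise the entries of [w] one after the other: [msum] is affine in each of
    them, and by [msum_ratio_le] the relative slope in entry [i] only decreases
    when other entries have been raised before, so that the initial slopes
    bound the growth. *)
Lemma msum_raise C S w u : uniq C ->
    {in S, forall i, 0 <= w i} -> {in S, forall i, 0 <= u i} ->
    0 < msum C S w ->
  msum C S (fun i => w i + u i) <=
    msum C S w * \prod_(i in S) (1 + u i * msum C (S :\ i) w / msum C S w).
Proof.
move=> uC w_ge0 u_ge0 A_gt0; set A := msum C S w in A_gt0 *.
pose wU (U : seq V) i := w i + (if i \in U then u i else 0).
(* [wU U] is [w] after its entries in [U] have been raised. *)
have ->: msum C S (fun i => w i + u i) = msum C S (wU (enum S)).
  by apply: eq_msum => i Si; rewrite /wU mem_enum Si.
rewrite -big_enum /=.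
have: {subset enum S <= S} by move=> i; rewrite mem_enum.
elim: (enum S) (enum_uniq S) => [|i U IH] /=.
  rewrite big_nil mulr1 (eq_msum _ _ _ w) // => i _.
  by rewrite /wU in_nil addr0.
case/andP=> iNU uU subU; rewrite big_cons mulrCA.
have Si : i \in S by apply: subU; rewrite mem_head.
have subU' : {subset U <= S} by move=> j Uj; apply: subU; rewrite inE Uj orbT.
have lew : {in S, forall j, 0 <= w j <= wU U j}.
  move=> j Sj; rewrite w_ge0 // lerDl; by case: ifP => _; [apply: u_ge0 | apply: lexx].
have F_ge0 : 0 <= u i * msum C (S :\ i) w / A.
  rewrite divr_ge0 ?(ltW A_gt0) // mulr_ge0 ?u_ge0 //.
  by apply: msum_ge0 => k /setD1P[_ /w_ge0].
apply: (@le_trans _ _ ((1 + u i * msum C (S :\ i) w / A) * msum C S (wU U))).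
  rewrite (msum_affine C S (wU U) _ i) //; last first.
    by move=> j /setD1P[jNi _]; rewrite /wU inE (negbTE jNi).
  rewrite /wU mem_head (negbTE iNU) addr0 addrAC subrr add0r -/(wU U).
  rewrite mulrDl mul1r lerD2l -!mulrA ler_wpM2l ?u_ge0 //.
  rewrite mulrA mulrAC ler_pdivlMr // mulrC [leRHS]mulrC.
  exact: msum_ratio_le.
by rewrite ler_wpM2l ?IH // addr_ge0.
Qed.

(** With a single unmatched row, [msum] is a linear form in [w]. *)
Lemma msum_raise_last C S w u : uniq C -> #|S| = (size C).+1 ->
  msum C S (fun i => w i + u i) =
    msum C S w + \sum_(i in S) u i * msum C (S :\ i) w.
Proof.
move=> uC cardS.
pose wU (U : seq V) i := w i + (if i \in U then u i else 0).
have ->: msum C S (fun i => w i + u i) = msum C S (wU (enum S)).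
  by apply: eq_msum => i Si; rewrite /wU mem_enum Si.
rewrite -big_enum /=.
have: {subset enum S <= S} by move=> i; rewrite mem_enum.
elim: (enum S) (enum_uniq S) => [|i U IH] /=.
  rewrite big_nil addr0 (eq_msum _ _ _ w) // => i _.
  by rewrite /wU in_nil addr0.
case/andP=> iNU uU subU; rewrite big_cons addrCA.
have Si : i \in S by apply: subU; rewrite mem_head.
have subU' : {subset U <= S} by move=> j Uj; apply: subU; rewrite inE Uj orbT.
rewrite (msum_affine C S (wU U) _ i) //; last first.
  by move=> j /setD1P[jNi _]; rewrite /wU inE (negbTE jNi).
rewrite /wU mem_head (negbTE iNU) addr0 addrAC subrr add0r -/(wU U).
rewrite IH // addrC; congr (_ + _ * _); apply: eq_msum_card.
by rewrite -ltnS -cardS (cardsD1 i S) Si.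
Qed.

(** Matchings of two disjoint pieces can be glued. *)
Lemma msum_cat C1 C2 S1 S2 w : [disjoint S1 & S2] -> #|S2| = size C2 ->
    {in S1 :|: S2, forall i, 0 <= w i} ->
  msum C1 S1 w * msum C2 S2 w <= msum (C2 ++ C1) (S1 :|: S2) w.
Proof.
elim: C2 S2 => [|c C2 IH] S2 /=.
  by move=> _ /eqP; rewrite cards_eq0 => /eqP-> _; rewrite big_set0 setU0 mulr1.
move=> dis cardS2 w_ge0.
rewrite big_distrr [leRHS](bigID (mem S2)) /= ler_wpDr //.
  apply: sumr_ge0 => i _; rewrite mulr_ge0 ?msum_ge0 // => j /setD1P[_].
  exact: w_ge0.
rewrite [leRHS](eq_bigl (mem S2)) => [|i]; last first.
  by rewrite !inE /=; case: (i \in S2); rewrite ?andbF ?orbT.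
apply: ler_sum => i /= S2i; rewrite mulrCA ler_wpM2l //.
have -> : (S1 :|: S2) :\ i = S1 :|: (S2 :\ i).
  rewrite setDUl; congr (_ :|: _); apply/setDidPl.
  by rewrite disjoint_sym disjoints1 (disjointFl dis S2i).
apply: IH => [||j].
- by apply: disjointWr dis; apply: subsetDl.
- by apply/eqP; rewrite -eqSS -cardS2 (cardsD1 i S2) S2i.
rewrite !inE => S12j; apply: w_ge0; rewrite inE.
by case/orP: S12j => [->|/andP[_ ->]] //; rewrite orbT.
Qed.

End MatchingSum.

(** * The number of perfect matchings of a regular bipartite graph *)

Section Capacity.
Variable R : realFieldType.

(** The least possible slope at [0] of a function [A * (1 + s * t / k) ^+ k] that
    is at least [t] for all [t > 0].  For [k <= 1] the formula reads
    [0 ^+ 0 = 1]. *)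
Definition gurvits (k : nat) : R := (k.-1%:R / k%:R) ^+ k.-1.

Lemma gurvits_ge0 k : 0 <= gurvits k.
Proof. by rewrite exprn_ge0 // divr_ge0. Qed.

Lemma gurvits_gt0 k : 0 < gurvits k.
Proof.
case: k => [|[|k]]; rewrite /gurvits ?expr0 // exprn_gt0 //.
by rewrite divr_gt0 ?ltr0n.
Qed.

Lemma gurvits_le1 k : gurvits k <= 1.
Proof.
case: k => [|k]; rewrite /gurvits ?expr0 //= exprn_ile1 ?divr_ge0 //.
by rewrite ler_pdivrMr ?ltr0n // mul1r ler_nat.
Qed.

Lemma slope_ge (A B M : R) : (forall t, 0 < t -> M * t <= A + t * B) -> M <= B.
Proof.
move=> H; rewrite leNgt; apply/negP => ltBM.
have t_gt0 : 0 < (`|A| + 1) / (M - B).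
  by rewrite divr_gt0 ?subr_gt0 // ltr_wpDl.
have := H _ t_gt0; rewrite -lerBlDr mulrC -mulrBr divfK; last first.
  by rewrite gt_eqF // subr_gt0.
by move=> /le_trans /(_ (ler_norm A)); rewrite gerDl ler10.
Qed.

(** The upper bound on [M * t] is used where its quotient by [t] is minimal, at
    [t = k * A / (k.-1 * B)]; for [k = 1] this point is at infinity. *)
Lemma slope_ge_gurvits (A B M : R) k : 0 < A -> 0 <= B -> 0 < M -> (0 < k)%N ->
    (forall t, 0 < t -> M * t <= A * (1 + t * B / A / k%:R) ^+ k) ->
  M * gurvits k <= B.
Proof.
move=> A_gt0 B_ge0 M_gt0; case: k => [//|[|k]] _ H.
  rewrite /gurvits expr0 mulr1; apply: (@slope_ge A) => t /H.
  by rewrite divr1 expr1 mulrDr mulr1 mulrCA mulfV ?gt_eqF // mulr1.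
rewrite /gurvits /=; set K := k.+2%:R in H *; set K1 := k.+1%:R.
have K_gt0 : 0 < K by rewrite ltr0n.
have K1_gt0 : 0 < K1 by rewrite ltr0n.
have KE : K = K1 + 1 by rewrite /K /K1 -natr1.
clearbody K K1.
have [B0|B_gt0] := eqVneq B 0.
  have t_gt0 : 0 < (A + 1) / M by rewrite divr_gt0 ?addr_gt0.
  have := H _ t_gt0; rewrite B0 mulr0 !mul0r addr0 expr1n mulr1 mulrC divfK ?gt_eqF //.
  by rewrite gerDl ler10.
have {B_ge0}B_gt0 : 0 < B by rewrite lt0r B_gt0.
have t_gt0 : 0 < K * A / (K1 * B) by rewrite divr_gt0 ?mulr_gt0.
have := H _ t_gt0.
have -> : 1 + K * A / (K1 * B) * B / A / K = K / K1.
  by rewrite KE; field; rewrite -KE !gt_eqF.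
rewrite exprSr -[K1 / K]invf_div exprVn => le1.
rewrite ler_pdivrMr ?exprn_gt0 ?divr_gt0 //.
have : M * (K * A / (K1 * B)) * (K1 * B / (A * K))  <=
   A * ((K / K1) ^+ k.+1 * (K / K1)) * (K1 * B / (A * K)).
  by rewrite ler_wpM2r // ltW // divr_gt0 ?mulr_gt0.
have -> : M * (K * A / (K1 * B)) * (K1 * B / (A * K)) = M.
  by field; rewrite !gt_eqF.
set X := _ ^+ _; suff -> : A * (X * (K / K1)) * (K1 * B / (A * K)) = B * X by [].
by field; rewrite !gt_eqF.
Qed.

Variables (V L : finType) (r : V -> L -> bool).
Local Notation a := (fun i c => (r i c)%:R : R).
Local Notation P := (msum R V L a).

Lemma weight_ge0 i c : 0 <= a i c.
Proof. exact: ler0n. Qed.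

(** Only the [k] rows that meet column [c] contribute to the product of
    [msum_raise]; the arithmetic-geometric inequality equalizes their slopes,
    whose sum is [msum (c :: C)]. *)
Lemma msum_raise_le C (S : {set V}) (w : V -> R) c k (t : R) : uniq C -> (0 < k)%N ->
    #|[set i in S | r i c]| = k -> {in S, forall i, 0 < w i} ->
    0 <= t -> 0 < P C S w ->
  P C S (fun i => w i + a i c * t) <=
    P C S w * (1 + t * P (c :: C) S w / P C S w / k%:R) ^+ k.
Proof.
move=> uC k_gt0 cardN w_gt0 t_ge0 A_gt0.
have u_ge0 : {in S, forall i, 0 <= a i c * t} by move=> i _; rewrite mulr_ge0.
apply: le_trans (msum_raise _ _ _ _ weight_ge0 _ _ _ _ uC _ u_ge0 A_gt0) _.
  by move=> i /w_gt0/ltW.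
rewrite ler_wpM2l ?(ltW A_gt0) //.
set A := P C S w in A_gt0 *; set N := [set i in S | r i c] in cardN.
pose E i := 1 + t * P C (S :\ i) w / A.
have -> : \prod_(i in S) (1 + a i c * t * P C (S :\ i) w / A) = \prod_(i in N) E i.
  rewrite (bigID (r^~ c)) /= [X in _ * X]big1 ?mulr1 => [|i /andP[_ /negPf->]].
    by apply: eq_big => i; rewrite ?inE // => /andP[_ ->]; rewrite mul1r.
  by rewrite !mul0r addr0.
have E_ge0 : {in N, forall i, 0 <= E i}.
  move=> i; rewrite inE => /andP[Si _].
  rewrite addr_ge0 // divr_ge0 ?(ltW A_gt0) // mulr_ge0 //.
  by apply: msum_ge0 => // j /setD1P[_ /w_gt0/ltW].
have [] := leif_AGM E_ge0; rewrite cardN => /le_trans le_E _; apply: le_E.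
rewrite le_eqVlt; apply/orP; left; apply/eqP; congr (_ ^+ _).
rewrite big_split /= sumr_const cardN mulrDl divff ?pnatr_eq0 -?lt0n //.
rewrite -mulr_suml -mulr_sumr; congr (1 + _ * _ / _ / _); rewrite [RHS](bigID (r^~ c)) /=.
rewrite [X in _ + X]big1 ?addr0 => [|i /andP[_ /negPf->]]; last by rewrite mul0r.
by apply: eq_big => i; rewrite ?inE // => /andP[_ ->]; rewrite mul1r.
Qed.

Section Regular.
Variables (d : nat) (S : {set V}) (D : {set L}).
Hypothesis d_gt0 : (0 < d)%N.
Hypothesis row_reg : {in S, forall i, #|[set c in D | r i c]| = d}.
Hypothesis col_reg : {in D, forall c, #|[set i in S | r i c]| = d}.

Lemma card_regular : #|S| = #|D|.
Proof.
apply/eqP; rewrite -(eqn_pmul2r d_gt0) -!sum_nat_const.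
rewrite -(eq_bigr _ row_reg) -(eq_bigr _ col_reg).
under eq_bigr => i _ do rewrite -sum1_card.
under [X in _ == X]eq_bigr => i _ do rewrite -sum1_card.
rewrite (exchange_big_dep (mem D)) /= => [|i c _]; last by rewrite inE => /andP[].
apply/eqP/eq_bigr => c Dc; apply: eq_bigl => i.
by rewrite !inE Dc.
Qed.

(** The arithmetic-geometric inequality in each row; every column is counted [d]
    times, so it is applied to [d]-th powers. *)
Lemma prod_row_sum_ge (x : L -> R) : {in D, forall c, 0 < x c} ->
  d%:R ^+ #|S| * \prod_(c in D) x c <=
    \prod_(i in S) \sum_(c in D) a i c * x c.
Proof.
move=> x_gt0; have d_gt0' : 0 < d%:R :> R by rewrite ltr0n.
have P_ge0 : 0 <= \prod_(c in D) x c by apply: prodr_ge0 => c /x_gt0/ltW.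
pose N i := [set c in D | r i c].
have rowE i : \sum_(c in D) a i c * x c = \sum_(c in N i) x c.
  rewrite (bigID (r i)) /= [X in _ + X]big1 ?addr0 => [|c /andP[_ /negPf->]].
    by apply: eq_big => c; rewrite ?inE // => /andP[_ ->]; rewrite mul1r.
  by rewrite mul0r.
have xN i : {in N i, forall c, 0 <= x c}.
  by move=> c; rewrite inE => /andP[/x_gt0/ltW].
rewrite -(ler_pXn2r d_gt0) ?nnegrE; first last.
- by apply: prodr_ge0 => i _; rewrite rowE; apply: sumr_ge0 => c; apply: xN.
- by rewrite mulr_ge0 // exprn_ge0.
rewrite exprMn -exprM mulnC exprM -!prodrXl.
have -> : \prod_(c in D) x c ^+ d = \prod_(i in S) \prod_(c in N i) x c.
  rewrite (eq_bigr (fun c => \prod_(i in [set i in S | r i c]) x c)); last first.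
    by move=> c Dc; rewrite prodr_const (col_reg c Dc).
  rewrite (exchange_big_dep (mem S)) /= => [|c i _]; last by rewrite inE => /andP[].
  by apply: eq_bigr => i Si; apply: eq_bigl => c; rewrite !inE Si.
rewrite -prodr_const -big_split /=; apply: ler_prod => i Si.
rewrite mulr_ge0 ?prodr_ge0 ?exprn_ge0 //=; last exact: xN.
have [] := leif_AGM (xN i); rewrite (row_reg i Si) => le_AGM _.
rewrite rowE mulrC -ler_pdivlMr ?exprn_gt0 // -expr_div_n.
exact: le_AGM.
Qed.

(** Gurvits' capacity inequality.  Adding [c] to [C] replaces the value of a
    function of [t = x c] by its slope at [0], and costs a factor [gurvits d]
    by [slope_ge_gurvits].  It is convenient that [w] may exceed the row sums:
    all its entries can then be kept positive, which avoids any limit. *)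
Lemma msum_capacity C (x : L -> R) (w : V -> R) :
    uniq C -> {subset C <= D} -> {in D, forall c, 0 < x c} ->
    {in S, forall i, 0 < w i} ->
    {in S, forall i, \sum_(c in D | c \notin C) a i c * x c <= w i} ->
  d%:R ^+ #|S| * gurvits d ^+ size C * \prod_(c in D | c \notin C) x c <=
    P C S w.
Proof.
elim: C x w => [|c C IH] x w uC sCD x_gt0 w_gt0 le_w.
  rewrite expr0 mulr1 (eq_bigl (mem D)) => [|c]; last by rewrite andbT.
  apply: le_trans (prod_row_sum_ge x x_gt0) _ => /=.
  apply: ler_prod => i Si; rewrite sumr_ge0 => [|c Dc].
    apply: le_trans (le_w i Si); rewrite le_eqVlt; apply/orP; left.
    by apply/eqP/eq_bigl => c; rewrite andbT.
  by rewrite mulr_ge0 // ltW // x_gt0.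
have Dc : c \in D by apply: sCD; rewrite mem_head.
case/andP: (uC) => cNC uC'.
have sCD' : {subset C <= D} by move=> j Cj; apply: sCD; rewrite inE Cj orbT.
set Q := \prod_(_ in _ | _) _.
have Q_gt0 : 0 < Q by apply: prodr_gt0 => j /andP[/x_gt0].
pose M := d%:R ^+ #|S| * gurvits d ^+ size C * Q.
have M_gt0 : 0 < M.
  apply: mulr_gt0 => //; apply: mulr_gt0; apply: exprn_gt0; first by rewrite ltr0n.
  exact: gurvits_gt0.
have -> : d%:R ^+ #|S| * gurvits d ^+ size (c :: C) * Q = M * gurvits d.
  by rewrite /M exprSr; ring.
have w_ge0 : {in S, forall i, 0 <= w i} by move=> i /w_gt0/ltW.
(* Raising [w] by [t] times column [c] makes room for [x c = t]. *)
have key t : 0 < t -> M * t <= P C S (fun i => w i + a i c * t).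
  move=> t_gt0; pose y j := if j == c then t else x j.
  have -> : M * t = d%:R ^+ #|S| * gurvits d ^+ size C *
       \prod_(j in D | j \notin C) y j.
    rewrite /M -mulrA; congr (_ * _).
    rewrite [RHS](bigD1 c) ?Dc ?cNC //= {1}/y eqxx mulrC; congr (_ * _).
    apply: eq_big => [j|j]; rewrite inE negb_or.
      by rewrite -andbA; congr (_ && _); rewrite andbC.
    by case/and3P=> _ /negPf jNc _; rewrite /y jNc.
  apply: IH => // [j Dj|i Si|i Si].
  - by rewrite /y; case: eqP => // _; apply: x_gt0.
  - by rewrite ltr_wpDr ?w_gt0 // mulr_ge0 // (ltW t_gt0).
  rewrite (bigD1 c) ?Dc ?cNC //= {1}/y eqxx addrC lerD2r.
  apply: le_trans (le_w i Si); rewrite le_eqVlt; apply/orP; left; apply/eqP.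
  apply: eq_big => [j|j]; rewrite ?inE ?negb_or.
    by rewrite -andbA; congr (_ && _); rewrite andbC.
  by case/andP=> _ /negPf jNc; rewrite /y jNc.
have A_gt0 : 0 < P C S w.
  rewrite lt0r msum_ge0 // andbT; apply/eqP => A0.
  have := key 1 ltr01; rewrite (msum_eq0 _ _ _ _ weight_ge0 _ _ w) // mulr1.
  by rewrite leNgt M_gt0.
apply: (slope_ge_gurvits (P C S w)) => //.
  by apply: msum_ge0.
move=> t t_gt0; apply: le_trans (key t t_gt0) _.
by apply: msum_raise_le => //; [apply: col_reg | apply: ltW].
Qed.

(** The exponent of [gurvits d] is one less than the number of columns, because
    before the last column is added [msum] is linear: its slope costs nothing.
    In the end this saves one factor per connected component. *)
Lemma regular_msum_ge C (w : V -> R) : uniq C -> C =i D -> D != set0 ->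
  d%:R ^+ #|D| * gurvits d ^+ #|D|.-1 <= P C S w.
Proof.
move=> uC eqCD D_neq0.
have sizeC : size C = #|D| by rewrite -(card_uniqP uC); apply: eq_card.
case: C => [|c C] in uC eqCD sizeC *.
  by case/set0Pn: D_neq0 => c; rewrite -eqCD.
case/andP: (uC) => cNC uC'; have Dc : c \in D by rewrite -eqCD mem_head.
have sCD j : j \in C -> j \in D by rewrite -eqCD inE => ->; rewrite orbT.
rewrite (eq_msum_card _ _ _ _ _ _ _ (fun=> 1)); last first.
  by rewrite card_regular sizeC.
apply: (@slope_ge (P C S (fun=> 1))) => t t_gt0.
have lone : [pred j in D | j \notin C] =1 pred1 c.
  move=> j; rewrite /= -eqCD inE; case: eqP => [->|_] //=.
  by rewrite andbN.
have := msum_capacity C (fun=> t) (fun i => 1 + a i c * t) uC' sCD.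
rewrite (eq_bigl _ _ lone) big_pred1_eq card_regular -sizeC /= => cap.
apply: le_trans (cap _ _ _) _ => [//|i _|i _|].
- by rewrite ltr_wpDr // mulr_ge0 // ltW.
- by rewrite (eq_bigl _ _ lone) big_pred1_eq lerDr.
rewrite msum_raise_last //; last by rewrite card_regular -sizeC.
rewrite lerD2l mulr_sumr; apply: ler_sum => i _.
by rewrite -mulrA mulrCA.
Qed.

Definition gurvits_growth : R := d%:R * gurvits d.

Lemma regular_msum_ge_growth C (w : V -> R) : uniq C -> C =i D -> D != set0 ->
  gurvits_growth ^+ #|D| <= gurvits d * P C S w.
Proof.
move=> uC eqCD D_neq0; have := regular_msum_ge C w uC eqCD D_neq0.
move=> /(ler_wpM2l (gurvits_ge0 d)); apply: le_trans.
by rewrite mulrCA -exprS prednK ?exprMn // card_gt0.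
Qed.

Lemma regular_msum_ge_growth_weak C (w : V -> R) : uniq C -> C =i D ->
  gurvits_growth ^+ #|D| <= P C S w.
Proof.
move=> uC eqCD; have [D0|D_neq0] := eqVneq D set0.
  have -> : C = [::].
    by apply/nilP; rewrite /nilp -(card_uniqP uC) (eq_card eqCD) D0 cards0.
  have /eqP : #|S| = 0%N by rewrite card_regular D0 cards0.
  by rewrite cards_eq0 D0 cards0 /= => /eqP->; rewrite big_set0.
apply: le_trans (regular_msum_ge_growth C w uC eqCD D_neq0) _.
rewrite ler_piMl ?gurvits_le1 // (eq_msum_card _ _ _ _ _ _ _ (fun=> 1)).
  by apply: msum_ge0.
by rewrite card_regular -(card_uniqP uC) (eq_card eqCD).
Qed.

End Regular.
End Capacity.

(** * Labelled hypergraphs: colourings and matchings *)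

(** A family [h : X -> {set X}] is a hypergraph with labelled, possibly repeated
    edges, having as many edges as vertices; labels are taken in [X] itself so
    that a matching of labels to vertices is a permutation. *)
Definition star (X : finType) (h : X -> {set X}) (v : X) : {set X} :=
  [set l | v \in h l].

(** Colourings of the labels in [D] that are proper around each vertex.  Labels
    outside [D] get the dummy colour [k0], so that counting them makes sense
    inside one finite type. *)
Definition partial_colorings (X K : finType) (k0 : K) (h : X -> {set X})
    (D : {set X}) : {set {ffun X -> K}} :=
  [set c : {ffun X -> K} | [forall l, (l \in D) || (c l == k0)]
           && [forall v, dinjectiveb c (star X h v :&: D)]].

Definition matchings (X : finType) (h : X -> {set X}) : {set {perm X}} :=
  [set p : {perm X} | [forall l, p l \in h l]].

(** The ways of ordering each edge so that, at each of the [d] positions, every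
    vertex occurs exactly once. *)
Definition perm_tuples (X : finType) (d : nat) (h : X -> {set X}) :
    {set {ffun 'I_d -> {perm X}}} :=
  [set p : {ffun 'I_d -> {perm X}} | [forall l, h l == [set p j l | j : 'I_d]]].

Section Colorings.
Variables (X K : finType) (k0 : K) (h : X -> {set X}).
Local Notation star := (star X h).
Local Notation pcol := (partial_colorings X K k0 h).

Lemma pcolP (D : {set X}) (c : {ffun X -> K}) :
  reflect ((forall l, l \notin D -> c l = k0) /\
           forall v, {in star v :&: D &, injective c}) (c \in pcol D).
Proof.
rewrite inE; apply: (iffP andP) => [[/forallP out /forallP inj]|[out inj]]; split.
- by move=> l lD; apply/eqP; have := out l; rewrite (negPf lD).
- by move=> v; apply/dinjectiveP/inj.
- by apply/forallP => l; rewrite -implyNb; apply/implyP => /out->.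
- by apply/forallP => v; apply/dinjectiveP.
Qed.

Lemma card_pcol0 : #|pcol set0| = 1%N.
Proof.
apply/eqP/cards1P; exists [ffun=> k0]; apply/setP => c; rewrite inE.
apply/pcolP/eqP => [[out _]|->].
  by apply/ffunP => l; rewrite ffunE out ?inE.
by split=> [l _|v l l']; rewrite ?ffunE // setI0 inE.
Qed.

(** The colour of [l] avoids those already present around [v]. *)
Lemma card_pcolU1 (D : {set X}) l v : l \notin D -> l \in star v ->
  (#|pcol (l |: D)| <= #|pcol D| * (#|K| - #|star v :&: D|))%N.
Proof.
move=> lD lv; pose forget (c : {ffun X -> K}) := [ffun x => if x == l then k0 else c x].
have forgetP c : c \in pcol (l |: D) -> forget c \in pcol D.
  case/pcolP=> out inj; apply/pcolP; split=> [x xD|u x y].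
    by rewrite ffunE; case: eqP => // /eqP xl; rewrite out // !inE negb_or xl.
  rewrite !inE !ffunE => /andP[xu xD] /andP[yu yD].
  case: eqP => [xl|_]; first by rewrite xl (negPf lD) in xD.
  case: eqP => [yl|_]; first by rewrite yl (negPf lD) in yD.
  by apply: (inj u); rewrite !inE ?xu ?yu ?xD ?yD orbT.
rewrite -sum1_card (partition_big forget (mem (pcol D))) //=.
rewrite -sum_nat_const; apply: leq_sum => b Db; have [_ inj_b] := elimT (pcolP _ _) Db.
rewrite sum1dep_card -(card_in_imset (inj_b v)).
have -> : (#|K| - #|b @: (star v :&: D)| = #|~: (b @: (star v :&: D))|)%N.
  by rewrite -(cardsC (b @: (star v :&: D))) addKn.
rewrite -(@card_in_imset _ _ (fun c : {ffun X -> K} => c l)).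
  apply: subset_leq_card; apply/subsetP => _ /imsetP[c + ->].
  rewrite in_set => /andP[/pcolP[_ inj] /eqP cb]; rewrite inE.
  apply/imsetP => -[x /[!inE] /andP[xv xD]].
  have xNl : x != l by apply: contraNneq lD => <-.
  rewrite -cb ffunE (negPf xNl) => clx; move: xNl; rewrite -(inj v l x) ?eqxx //.
    by move: lv; rewrite !inE eqxx => ->.
  by rewrite !inE xv xD orbT.
move=> c c'; rewrite !in_set => /andP[_ /eqP cb] /andP[_ /eqP c'b] eq_l.
apply/ffunP => x; have := congr1 (fun f : {ffun X -> K} => f x) (etrans cb (esym c'b)).
by rewrite !ffunE; case: eqP => // ->.
Qed.

Lemma card_pcolU_star (D : {set X}) v : #|star v| = #|K| ->
  (#|pcol (D :|: star v)| <= #|pcol D| * #|star v :\: D|`!)%N.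
Proof.
move=> starK; move: {2}#|star v :\: D| (erefl #|star v :\: D|) => s.
elim: s D => [|s IH] D cardD.
  rewrite cardD muln1; have /eqP := cardD; rewrite cards_eq0 setD_eq0.
  by move/setUidPl=> ->.
have /set0Pn[l /setDP[lv lD]] : star v :\: D != set0 by rewrite -card_gt0 cardD.
have starD : (#|K| - #|star v :&: D| = s.+1)%N.
  by rewrite -starK -(cardsID D) addKn.
have setUl : (l |: D) :|: star v = D :|: star v.
  by rewrite -setUA (setUidPr _) // sub1set inE lv orbT.
have cardl : #|star v :\: (l |: D)| = s.
  rewrite [l |: D]setUC -setDDl; apply/eqP.
  by rewrite -eqSS -cardD (cardsD1 l (star v :\: D)) in_setD lD lv.
rewrite -setUl; apply: leq_trans (IH _ cardl) _.
rewrite cardl cardD factS mulnA leq_mul2r; apply/orP; right.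
by rewrite -starD; apply: card_pcolU1.
Qed.

End Colorings.

Section MatchingCount.
Variables (R : realFieldType) (X : finType) (h : X -> {set X}).
Local Notation P := (msum R X X (fun i c => (i \in h c)%:R)).

(** The permutation [p0] only serves to represent partial matchings by total
    permutations: it fixes the values outside [C].  Matching [c] to the row
    [p0 k] amounts to swapping [c] and [k] in [p0] before the next columns are
    treated. *)
Lemma msum_le_card C (p0 : {perm X}) (w : X -> R) : uniq C ->
  P C (p0 @: [set l in C]) w <=
    #|[set p : {perm X} | all (fun l => p l \in h l) C
        && [forall l, (l \notin C) ==> (p l == p0 l)]]|%:R.
Proof.
elim: C p0 => [|c C IH] p0.
  rewrite /= => _; rewrite big_pred0 => [|i].
    rewrite (_ : [set p | _] = [set p0]) ?cards1 //.
    apply/setP => p; rewrite !inE /=; apply/forallP/eqP => [eqp|-> //].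
    by apply/permP => l; apply/eqP/eqp.
  by apply/imsetP => -[l]; rewrite inE.
set Om := [set p : {perm X} | _ & _]; case/andP=> cNC uC.
rewrite -sum1_card (partition_big (fun p : {perm X} => p c) predT) //=.
rewrite natr_sum big_mkcond /=; apply: ler_sum => i _.
case: ifP => [|_]; last exact: ler0n.
case/imsetP=> k; rewrite inE => Ck ->{i}.
case hc: (p0 k \in h c); last by rewrite mul0r.
rewrite mul1r; pose q := (tperm c k * p0)%g.
have qc : q c = p0 k by rewrite permM tpermL.
have qout l : l \notin c :: C -> q l = p0 l.
  rewrite inE negb_or => /andP[lc lC]; rewrite permM tpermD // eq_sym //.
  apply: contraNneq lC => kl; by move: Ck; rewrite inE -kl (negPf lc).
have -> : (p0 @: [set l in c :: C]) :\ p0 k = q @: [set l in C].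
  have -> : p0 @: [set l in c :: C] = q @: [set l in c :: C].
    rewrite /q; apply/setP => y.
    apply/imsetP/imsetP => -[l lC ->].
      exists (tperm c k l); last by rewrite permM tpermK.
      by move: lC; rewrite !inE; case: tpermP => [_ _|_ _|//]; rewrite ?eqxx -?in_cons.
    exists (tperm c k l); last by rewrite permM.
    by move: lC; rewrite !inE; case: tpermP => [_ _|_ _|//]; rewrite ?eqxx -?in_cons.
  rewrite set_cons imsetU1 qc setU1K // -qc; apply/imsetP => -[l].
  by rewrite inE => lC /perm_inj cl; rewrite cl lC in cNC.
apply: le_trans (IH q uC) _; rewrite ler_nat sum1dep_card.
apply: subset_leq_card; apply/subsetP => p; rewrite !inE => /andP[pC /forallP pq].
have pc : p c = p0 k by have := pq c; rewrite cNC qc => /eqP.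
rewrite /= pC pc hc eqxx andbT /=; apply/forallP => l; apply/implyP => lC.
rewrite -(qout l lC); apply: (implyP (pq l)).
by move: lC; rewrite inE negb_or => /andP[].
Qed.

Lemma msum_le_matchings C (w : X -> R) : uniq C -> C =i [set: X] ->
  P C [set: X] w <= #|matchings X h|%:R.
Proof.
move=> uC CT; have := msum_le_card C 1%g w uC.
have -> : (1%g : {perm X}) @: [set l in C] = setT.
  by apply/setP => x; rewrite inE; apply/imsetP; exists x; rewrite ?perm1 // inE CT inE.
move/le_trans; apply; rewrite ler_nat; apply: subset_leq_card.
apply/subsetP => p; rewrite !inE => /andP[/allP pC _].
by apply/forallP => l; apply: pC; rewrite CT inE.
Qed.

End MatchingCount.

(** * Comparison over connected components *)

Section Components.
Variables (R : realFieldType) (X K : finType) (k0 : K) (h : X -> {set X}).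
Local Notation d := #|K|.
Local Notation star := (star X h).
Local Notation pcol := (partial_colorings X K k0 h).
Local Notation P := (msum R X X (fun i c => (i \in h c)%:R)).
Hypothesis uniform_h : forall l, #|h l| = d.
Hypothesis regular_h : forall v, #|star v| = d.

Let d_gt0 : (0 < d)%N. Proof. by rewrite -cardsT card_gt0; apply/set0Pn; exists k0. Qed.

(** A union of connected components, as a set of labels. *)
Definition star_closed (D : {set X}) :=
  [forall v, (star v \subset D) || [disjoint star v & D]].

(** The vertices of a union of connected components. *)
Definition rows (D : {set X}) : {set X} := [set v | star v \subset D].

Lemma star_neq0 v : exists l, l \in star v.
Proof. by apply/set0Pn; rewrite -card_gt0 regular_h. Qed.

Lemma edge_neq0 l : exists v, l \in star v.
Proof.
have /set0Pn[v vl] : h l != set0 by rewrite -card_gt0 uniform_h.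
by exists v; rewrite inE.
Qed.

Lemma star_closedP D v l : star_closed D -> l \in D -> l \in star v ->
  star v \subset D.
Proof.
move=> /forallP/(_ v)/orP[] // dis lD lv.
by rewrite (disjointFr dis lv) in lD.
Qed.

Lemma star_closedD D E : star_closed D -> star_closed E -> star_closed (E :\: D).
Proof.
move=> cD cE; apply/forallP => v; rewrite subsetD.
case/orP: (forallP cE v) => [->|dis] /=; last first.
  by rewrite (disjointWr (subsetDl E D) dis) orbT.
case/orP: (forallP cD v) => [sD|->//].
rewrite orbC disjoint_sym (disjointWr sD) // -setI_eq0.
by apply/eqP/setP => x; rewrite !inE andbAC andNb.
Qed.

Lemma rows_regular D :
  {in rows D, forall v, #|[set l in D | v \in h l]| = d}.
Proof.
move=> v; rewrite inE => sD; rewrite -(regular_h v); congr #|pred_of_set _|.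
apply/setP => l; rewrite !inE andbC; case vl: (v \in h l) => //=.
by apply: (subsetP sD); rewrite inE.
Qed.

Lemma labels_regular D : star_closed D ->
  {in D, forall l, #|[set v in rows D | v \in h l]| = d}.
Proof.
move=> cD l lD; rewrite -(uniform_h l); congr #|pred_of_set _|.
apply/setP => v; rewrite !inE andbC; case vl: (v \in h l) => //=.
by apply: (star_closedP _ _ l) => //; rewrite inE.
Qed.

Lemma rows_card D : star_closed D -> #|rows D| = #|D|.
Proof.
move=> cD; apply: (card_regular X X (fun v l => v \in h l) d _ _ d_gt0).
  exact: rows_regular.
exact: labels_regular.
Qed.

Local Notation g := (gurvits R d).
Local Notation beta := (gurvits_growth R d).

Lemma msum_closed_ge D C w : star_closed D -> uniq C -> C =i D -> D != set0 ->
  beta ^+ #|D| <= g * P C (rows D) w.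
Proof.
move=> cD; apply: (regular_msum_ge_growth R X X (fun v l => v \in h l)) => //.
  exact: rows_regular.
exact: labels_regular.
Qed.

(** [rho] bounds the number of choices per label in a greedy colouring: [s] new
    labels around a vertex that already has coloured ones get at most [s!]
    colourings.  The first star of a component may exceed this rate by the factor
    [(gurvits d)^-1], which the matching bound also gains in each component. *)
Variable rho : R.
Hypothesis rho_gt0 : 0 < rho.
Hypothesis fact_le_rho : forall s, (s < d)%N -> s`!%:R <= rho ^+ s.
Hypothesis fact_gurvits_le_rho : d`!%:R * g <= rho ^+ d.

(** Colour the star of a vertex outside [D], then greedily complete stars that
    are partially coloured.  A maximal set reachable in this way has no
    partially coloured star left, hence is closed. *)
Lemma exists_larger_closed D l : star_closed D -> l \notin D ->
  exists E, [/\ star_closed E, D \proper E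
    & #|pcol E|%:R * rho ^+ d <= d`!%:R * #|pcol D|%:R * rho ^+ #|E :\: D|].
Proof.
move=> cD lD; have [v vl] := edge_neq0 l.
(* The factor [d`!] pays for the first star, [rho] per label for the rest. *)
pose ok (E : {set X}) := (D \proper E) &&
  (#|pcol E|%:R * rho ^+ d <= d`!%:R * #|pcol D|%:R * rho ^+ #|E :\: D|).
have rho_ge0 := ltW rho_gt0.
have ok_star : ok (D :|: star v).
  have dis : [disjoint star v & D].
    have := forallP cD v; case/orP=> // /subsetP/(_ l vl).
    by rewrite (negPf lD).
  have starD : star v :\: D = star v by apply/setDidPl.
  rewrite /ok properE subsetUl subUset subxx /= setDUl setDv set0U starD.
  rewrite regular_h; apply/andP; split; first by apply/subsetPn; exists l.
  rewrite ler_wpM2r ?exprn_ge0 // -natrM ler_nat mulnC.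
  have := card_pcolU_star X K k0 h D v (regular_h v).
  by rewrite starD regular_h.
case: (arg_maxnP (fun E : {set X} => #|E|) ok_star) => E /andP[DE leE] maxE.
exists E; split=> //; apply/forallP => u; apply/norP => -[uNE uE].
set s := #|star u :\: E|.
have s_gt0 : (0 < s)%N by rewrite card_gt0 setD_eq0.
have s_lt : (s < d)%N.
  rewrite -(regular_h u) -(cardsID E (star u)) -[X in (X < _)%N]add0n ltn_add2r.
  by rewrite card_gt0 setI_eq0.
have DE' := proper_sub DE.
have cardE : #|(E :|: star u) :\: D| = (#|E :\: D| + s)%N.
  rewrite !cardsDS ?(subset_trans DE') ?subsetUl //.
  rewrite -(cardsID E (E :|: star u)) setUK setDUl setDv set0U.
  by rewrite -/s addnC -addnBA ?subset_leq_card // addnC.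
have leE_max := maxE (E :|: star u).
suff /leE_max: ok (E :|: star u).
  apply/negP; rewrite -ltnNge; apply: proper_card.
  by rewrite properE subsetUl subUset subxx.
rewrite /ok (proper_sub_trans DE (subsetUl _ _)) /= cardE.
have leU : #|pcol (E :|: star u)|%:R <= #|pcol E|%:R * s`!%:R :> R.
  by rewrite -natrM ler_nat card_pcolU_star.
apply: le_trans (ler_wpM2r (exprn_ge0 d rho_ge0) leU) _.
rewrite mulrAC exprD mulrA ler_pM ?mulr_ge0 ?exprn_ge0 //.
exact: fact_le_rho.
Qed.

Definition bounded_by_msum (D : {set X}) := exists C, [/\ uniq C, C =i D &
  #|pcol D|%:R * beta ^+ #|D| <= rho ^+ #|D| * P C (rows D) (fun=> 1)].

(** The matchings of [D] are glued with those of the new component, whose number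
    is estimated by [msum_closed_ge]. *)
Lemma extend_bounded D l : star_closed D -> bounded_by_msum D -> l \notin D ->
  exists E, [/\ star_closed E, D \proper E & bounded_by_msum E].
Proof.
move=> cD [C [uC CD leD]] lD.
have [E [cE DE leE]] := exists_larger_closed D l cD lD.
exists E; split=> //; pose C' := enum (E :\: D).
have DE' := proper_sub DE.
have beta_ge0 : 0 <= beta by rewrite mulr_ge0 // gurvits_ge0.
have rho_ge0 := ltW rho_gt0.
exists (C' ++ C); split.
- rewrite cat_uniq enum_uniq uC andbT /=; apply/hasPn => c; rewrite CD => Dc.
  by rewrite mem_enum inE Dc.
- move=> c; rewrite mem_cat mem_enum CD inE.
  by case Dc: (c \in D); rewrite ?orbF //= (subsetP DE').
have cardE : #|E| = (#|D| + #|E :\: D|)%N by rewrite -(cardsID D E) (setIidPr DE').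
have cB := star_closedD _ _ cD cE.
have leB : beta ^+ #|E :\: D| <= g * P C' (rows (E :\: D)) (fun=> 1).
  apply: msum_closed_ge => //; first exact: enum_uniq.
    by move=> c; rewrite mem_enum.
  by rewrite setD_eq0; case/andP: DE.
have rowsE : rows E = rows D :|: rows (E :\: D).
  apply/setP => v; rewrite !inE subsetD; apply/idP/idP => [vE|].
    by rewrite vE; apply: (forallP cD).
  by case/orP=> [vD|/andP[]//]; apply: subset_trans DE'.
have dis : [disjoint rows D & rows (E :\: D)].
  rewrite -setI_eq0; apply/eqP/setP => v; rewrite !inE; apply/negP => /andP[vD vB].
  have [c cv] := star_neq0 v.
  by have := subsetP vB c cv; rewrite inE (subsetP vD).
have leP := msum_cat R X X _ (fun i c => ler0n R (i \in h c)) C C' _ _ (fun=> 1) dis.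
have {}leP : P C (rows D) (fun=> 1) * P C' (rows (E :\: D)) (fun=> 1) <=
    P (C' ++ C) (rows E) (fun=> 1).
  by rewrite rowsE leP ?rows_card // -(card_uniqP (enum_uniq _)) (eq_card (mem_enum _)).
have P_ge0 C0 S : 0 <= P C0 S (fun=> 1) by apply: msum_ge0.
rewrite -(ler_pM2r (exprn_gt0 d rho_gt0)) mulrAC.
apply: le_trans (ler_wpM2r (exprn_ge0 _ beta_ge0) leE) _.
rewrite cardE !exprD.
have -> : d`!%:R * #|pcol D|%:R * rho ^+ #|E :\: D| * (beta ^+ #|D| * beta ^+ #|E :\: D|)
   = d`!%:R * rho ^+ #|E :\: D| * ((#|pcol D|%:R * beta ^+ #|D|) * beta ^+ #|E :\: D|).
  by ring.
apply: (@le_trans _ _ (d`!%:R * rho ^+ #|E :\: D| *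
   ((rho ^+ #|D| * P C (rows D) (fun=> 1)) * (g * P C' (rows (E :\: D)) (fun=> 1))))).
  rewrite ler_wpM2l ?mulr_ge0 ?exprn_ge0 // ler_pM ?mulr_ge0 ?exprn_ge0 //.
set p1 := P C _ _; set p2 := P C' _ _; set p := P (C' ++ C) _ _.
have -> : d`!%:R * rho ^+ #|E :\: D| * (rho ^+ #|D| * p1 * (g * p2)) =
   rho ^+ #|D| * rho ^+ #|E :\: D| * (p1 * p2) * (d`!%:R * g) by ring.
apply: ler_pM => //; last by rewrite ler_wpM2l // mulr_ge0 ?exprn_ge0.
  by rewrite !mulr_ge0 ?exprn_ge0 ?P_ge0.
by rewrite mulr_ge0 ?gurvits_ge0.
Qed.

(** Colourings and matchings are compared component by component, starting from
    the empty set of labels. *)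
Lemma partial_colorings_le_matchings :
  #|pcol setT|%:R * beta ^+ #|X| <= rho ^+ #|X| * #|matchings X h|%:R.
Proof.
suff [C [uC CT le_T]] : bounded_by_msum setT.
  rewrite cardsT in le_T; apply: le_trans le_T _.
  rewrite ler_wpM2l ?exprn_ge0 ?(ltW rho_gt0) //.
  have -> : rows setT = setT by apply/setP => v; rewrite !inE subsetT.
  exact: msum_le_matchings.
have: exists D, [/\ star_closed D, bounded_by_msum D & (#|X| - #|D| <= #|X|)%N].
  exists set0; split; last exact: leq_subr.
    by apply/forallP => v; rewrite -setI_eq0 setI0 eqxx orbT.
  exists [::]; split=> [//|c|]; first by rewrite inE.
  have -> : rows set0 = set0.
    apply/setP => v; rewrite !inE subset0 -cards_eq0 regular_h.
    by rewrite eqn0Ngt d_gt0.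
  by rewrite card_pcol0 /= big_set0 cards0 !expr0 !mulr1.
move: {2}#|X| => m; elim: m => [|m IH] [D [cD bD leD]].
  suff <- : D = setT by [].
  by apply/eqP; rewrite eqEcard subsetT cardsT /= -subn_eq0 -leqn0.
case: (pickP [pred l | l \notin D]) => [l lD|DT].
  have [E [cE DE bE]] := extend_bounded D l cD bD lD.
  apply: IH; exists E; split=> //; rewrite -ltnS; apply: leq_trans leD.
  by rewrite ltn_sub2l // (leq_trans (proper_card DE)) // max_card.
suff <- : D = setT by [].
by apply/setP => l; rewrite inE; have := DT l; move/negbFE.
Qed.

End Components.

(** * Orderings of the edges of a regular hypergraph *)

Section PermTuples.
Variables (R : realFieldType) (X : finType).
Implicit Types h : X -> {set X}.

Definition delete_matching h (p : {perm X}) l := h l :\ p l.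

(** The first positions of the orderings form a matching; the remaining ones
    order the edges deprived of it. *)
Lemma card_perm_tuplesS d h (b : R) :
    {in matchings X h, forall p, b <= #|perm_tuples X d (delete_matching h p)|%:R} ->
  #|matchings X h|%:R * b <= #|perm_tuples X d.+1 h|%:R.
Proof.
move=> le_b; rewrite mulr_natl.
rewrite -[#|perm_tuples _ _ _|]sum1_card.
rewrite (partition_big (fun q : {ffun 'I_d.+1 -> {perm X}} => q ord0) predT) //=.
rewrite natr_sum -sumr_const big_mkcond /=; apply: ler_sum => p _.
case: ifP => [Mp|_]; last exact: ler0n.
apply: le_trans (le_b p Mp) _; rewrite ler_nat sum1dep_card.
pose cons (q : {ffun 'I_d -> {perm X}}) : {ffun 'I_d.+1 -> {perm X}} :=
  [ffun j => if unlift ord0 j is Some j' then q j' else p].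
have consK : injective cons.
  move=> q q' eq_qq'; apply/ffunP => j.
  have := congr1 (fun f : {ffun _ -> _} => f (lift ord0 j)) eq_qq'.
  by rewrite !ffunE liftK.
rewrite -(card_imset _ consK); apply: subset_leq_card; apply/subsetP => _ /imsetP[q + ->].
rewrite !inE => /forallP q_h; rewrite ffunE unlift_none eqxx andbT.
apply/forallP => l; apply/eqP/setP => v.
move: Mp; rewrite inE => /forallP/(_ l) pl.
have /eqP/setP/(_ v) := q_h l; rewrite !inE.
case: (eqVneq v (p l)) => [-> _|vp /= ->].
  by rewrite pl; apply/esym/imsetP; exists ord0; rewrite ?ffunE ?unlift_none.
apply/imsetP/imsetP => -[j _ vE]; rewrite vE.
  by exists (lift ord0 j); rewrite ?ffunE ?liftK.
rewrite vE ffunE in vp *; case: unliftP vp => [j' _ _|_]; last by rewrite eqxx.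
by exists j'.
Qed.

Lemma matchings_ge d h : (0 < d)%N ->
    (forall l, #|h l| = d) -> (forall v, #|star X h v| = d) ->
  gurvits_growth R d ^+ #|X| <= #|matchings X h|%:R.
Proof.
move=> d_gt0 uniform_h regular_h.
apply: le_trans (msum_le_matchings R X h (enum X) (fun=> 1) (enum_uniq _) _).
  rewrite -cardsT.
  apply: (regular_msum_ge_growth_weak R X X (fun v l => v \in h l)) => //.
  - move=> v _; rewrite -(regular_h v); congr #|pred_of_set _|.
    by apply/setP => l; rewrite !inE.
  - move=> l _; rewrite -(uniform_h l); congr #|pred_of_set _|.
    by apply/setP => v; rewrite !inE.
  - exact: enum_uniq.
  by move=> l; rewrite mem_enum !inE.
by move=> l; rewrite mem_enum !inE.
Qed.

Lemma card_delete_matching d h p : p \in matchings X h ->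
    (forall l, #|h l| = d.+1) -> (forall v, #|star X h v| = d.+1) ->
  (forall l, #|delete_matching h p l| = d)
  /\ (forall v, #|star X (delete_matching h p) v| = d).
Proof.
rewrite inE => /forallP ph uniform_h regular_h; split=> [l|v]; apply/eqP.
  by rewrite -eqSS -(uniform_h l) (cardsD1 (p l) (h l)) ph.
rewrite -eqSS -(regular_h v) (cardsD1 (p^-1%g v) (star X h v)) inE.
have := ph (p^-1%g v); rewrite permKV => ->; rewrite add1n eqSS; apply/eqP.
congr #|pred_of_set _|; apply/setP => l; rewrite !inE; congr (~~ _ && _).
by apply/eqP/eqP => [->|->]; rewrite ?permK ?permKV.
Qed.

(** Deleting matchings successively from a regular hypergraph lowers its degree
    by one each time. *)
Lemma perm_tuples_ge d h :
    (forall l, #|h l| = d) -> (forall v, #|star X h v| = d) ->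
  \prod_(j < d) gurvits_growth R j.+1 ^+ #|X| <= #|perm_tuples X d h|%:R.
Proof.
elim: d h => [|d IH] h uniform_h regular_h.
  rewrite big_ord0 ler1n card_gt0; apply/set0Pn; exists [ffun=> 1%g].
  rewrite inE; apply/forallP => l; apply/eqP/setP => v.
  have /eqP := uniform_h l; rewrite cards_eq0 => /eqP->; rewrite inE.
  by apply/esym/imsetP => -[[]].
rewrite big_ord_recr /= mulrC.
apply: le_trans (card_perm_tuplesS d h _ _) => [|p Mp]; last first.
  by apply: IH; have [] := card_delete_matching d h p Mp uniform_h regular_h.
rewrite ler_wpM2r ?matchings_ge // prodr_ge0 // => j _.
by rewrite exprn_ge0 // mulr_ge0 ?gurvits_ge0.
Qed.

Lemma prod_gurvits_growth d :
  \prod_(j < d) gurvits_growth R j.+1 = d`!%:R ^+ 2 / d%:R ^+ d.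
Proof.
elim: d => [|d IH]; first by rewrite big_ord0 fact0 !expr0 expr1n divr1.
rewrite big_ord_recr /= {}IH /gurvits_growth /gurvits /= factS natrM.
rewrite expr_div_n exprMn [d.+1%:R ^+ d.+1]exprSr.
have pow_neq0 : d%:R ^+ d != 0 :> R.
  by case: d => [|d]; rewrite ?oner_neq0 // expf_neq0 ?pnatr_eq0.
have powS_neq0 : d.+1%:R ^+ d != 0 :> R by rewrite expf_neq0 ?pnatr_eq0.
have S_neq0 : d.+1%:R != 0 :> R by rewrite pnatr_eq0.
move: (d.+1%:R) (d%:R ^+ d) (d.+1%:R ^+ d) S_neq0 pow_neq0 powS_neq0.
by move=> s q p s0 q0 p0; field; rewrite q0 p0 s0.
Qed.

End PermTuples.

Section FactorColorings.
Variables (R : realFieldType) (X : finType) (d' : nat) (h : X -> {set X}).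
Local Notation d := d'.+1.
Hypothesis uniform_h : forall l, #|h l| = d.

(** Colourings whose colour classes are 1-factors. *)
Definition factor_colorings : {set {ffun X -> 'I_d}} :=
  [set c : {ffun X -> 'I_d} |
    [forall v, [forall j, #|[set l | (c l == j) && (v \in h l)]| == 1%N]]].

(** The existence of a single such colouring already forces every vertex to have
    degree [d]: it meets each colour once. *)
Lemma factor_coloringsP (c : {ffun X -> 'I_d}) : c \in factor_colorings ->
  c \in partial_colorings X 'I_d ord0 h setT /\ forall v, #|star X h v| = d.
Proof.
rewrite inE => /forallP c1; split=> [|v].
  apply/pcolP; split=> [l|v l l']; rewrite !inE ?andbT // => lv l'v cl.
  have /cards1P[l0 E] := forallP (c1 v) (c l).
  have : l \in [set l0] by rewrite -E inE eqxx lv.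
  have : l' \in [set l0] by rewrite -E inE cl eqxx l'v.
  by rewrite !inE => /eqP-> /eqP->.
rewrite -sum1_card (partition_big c predT) //= -[RHS]card_ord -sum1_card.
apply: eq_bigr => j _; rewrite sum1dep_card -(eqP (forallP (c1 v) j)).
by apply: eq_card => l; rewrite !inE andbC.
Qed.

(** The first matching is compared with the colourings, and the [d'] others are
    counted by [perm_tuples_ge]. *)
Lemma factor_colorings_le rho : 0 < rho ->
    (forall s, (s < d)%N -> s`!%:R <= rho ^+ s) ->
    d`!%:R * gurvits R d <= rho ^+ d ->
  #|factor_colorings|%:R * (\prod_(j < d) gurvits_growth R j.+1 / rho) ^+ #|X|
    <= #|perm_tuples X d h|%:R.
Proof.
move=> rho_gt0 fact_le fact_gurvits_le.
have [->|[c Fc]] := set_0Vmem factor_colorings; first by rewrite cards0 mul0r.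
have [_ regular_h] := factor_coloringsP c Fc.
set B := \prod_(j < d') gurvits_growth R j.+1 ^+ #|X|.
have B_ge0 : 0 <= B.
  by apply: prodr_ge0 => j _; rewrite exprn_ge0 // mulr_ge0 ?gurvits_ge0.
apply: le_trans (card_perm_tuplesS R X d' h B _) => [|p Mp]; last first.
  apply: perm_tuples_ge;
  by have [] := card_delete_matching X d' h p Mp uniform_h regular_h.
have card_d : #|'I_d| = d := card_ord d.
have := partial_colorings_le_matchings R X 'I_d ord0 h.
rewrite card_d => /(_ uniform_h regular_h rho rho_gt0 fact_le fact_gurvits_le).
move=> le_pm; rewrite big_ord_recr /= expr_div_n exprMn -prodrXl -/B.
rewrite -!mulrA [B * _]mulrC !mulrA ler_wpM2r //.
rewrite ler_pdivrMr ?exprn_gt0 // [leRHS]mulrC; apply: le_trans le_pm.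
rewrite ler_wpM2r ?exprn_ge0 // ?mulr_ge0 ?gurvits_ge0 // ler_nat.
by apply: subset_leq_card; apply/subsetP => f /factor_coloringsP[].
Qed.

End FactorColorings.

(** * Tuples of 1-factors and diagonals *)

Section DoubleCounting.
Variables (X : finType) (W : {set {set X}}) (d' : nat).
Local Notation d := d'.+1.
Implicit Types h : {ffun X -> {set X}}.

Definition labellings : {set {ffun X -> {set X}}} :=
  [set h : {ffun X -> {set X}} | [forall l, h l \in W]].

Hypothesis W_uniform : uniform d W.

Lemma card_factor1 F : is_factor1 W F -> (#|F| * d = #|X|)%N.
Proof.
case/andP=> FW /forallP F1; rewrite -sum_nat_const.
rewrite (eq_bigr (fun e : {set X} => \sum_(v in e) 1)%N) => [|e Fe]; last first.
  rewrite sum1_card; apply/esym/eqP.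
  by apply: (implyP (forallP W_uniform e)); apply: (subsetP FW).
rewrite (exchange_big_dep predT) //= -sum1_card; apply: eq_bigr => v _.
rewrite sum1dep_card -(eqP (F1 v)); apply: eq_card => e.
by rewrite !inE.
Qed.

(** The disjoint union of the factors; by [card_tagged_factors] it has [#|X|]
    elements, so that it can be labelled by [X]. *)
Definition tagged_factors (F : {ffun 'I_d -> {set {set X}}}) :
    {set 'I_d * {set X}} := [set z : 'I_d * {set X} | z.2 \in F z.1].

Lemma card_tagged_factors (F : {ffun 'I_d -> {set {set X}}}) :
  (forall j, is_factor1 W (F j)) ->
  #|tagged_factors F| = #|X|.
Proof.
move=> F1; rewrite -sum1_card (partition_big fst predT) //=.
have F_card j : #|F j| = (#|X| %/ d)%N by rewrite -(card_factor1 _ (F1 j)) mulnK.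
rewrite (eq_bigr (fun=> #|X| %/ d)%N) => [|j _].
  rewrite sum_nat_const card_ord mulnC divnK //.
  by rewrite -(card_factor1 _ (F1 ord0)) dvdn_mull.
rewrite sum1dep_card -(F_card j).
transitivity #|[set (j, e) | e in F j]|; last by rewrite card_imset // => ? ? [].
apply: eq_card => -[j' e]; rewrite !inE /=.
apply/andP/imsetP => [[Fe /eqP jE]|[e' Fe' [-> ->]]]; last by [].
by exists e; rewrite ?jE // -jE.
Qed.

(** A [d]-tuple of 1-factors together with a labelling of its disjoint union is
    the same as a labelled hypergraph with a colouring by 1-factors, and there
    are [#|{perm X}|] labellings.  Labelling the edges avoids any discussion of
    repeated edges. *)
Lemma factor_tuples_le :
  (#|{perm X}| * num_factor1 W ^ d <=
    \sum_(h in labellings) #|factor_colorings X d' h|)%N.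
Proof.
pose tuples := [set F : {ffun 'I_d -> {set {set X}}} | [forall j, is_factor1 W (F j)]].
have cards_tuples : #|tuples| = (num_factor1 W ^ d)%N.
  have := card_ffun_on 'I_d [set F | is_factor1 W F]; rewrite card_ord => <-.
  apply: eq_card => F.
  rewrite inE; apply/forallP/ffun_onP => F1 j; have := F1 j; by rewrite inE.
rewrite -cards_tuples mulnC -cardsT -cardsX.
pose pairs := [set z : {ffun X -> {set X}} * {ffun X -> 'I_d} |
   (z.1 \in labellings) && (z.2 \in factor_colorings X d' z.1)].
have -> : (\sum_(h in labellings) #|factor_colorings X d' h| = #|pairs|)%N.
  rewrite -sum1_card (partition_big fst (mem labellings)) => [|z]; last first.
    by rewrite inE => /andP[].
  apply: eq_bigr => h Lh; rewrite sum1dep_card.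
  transitivity #|[set (h, c) | c in factor_colorings X d' h]|.
    by rewrite card_imset // => ? ? [].
  apply: eq_card => -[h' c]; rewrite [RHS]inE [_ \in pairs]inE /=.
  apply/imsetP/andP => [[c' Fc' [-> ->]]|[/andP[_ Fc] /eqP hE]].
    by rewrite Lh Fc' eqxx.
  by exists c; rewrite ?hE // -hE.
(* [b F] is a fixed labelling of the disjoint union, to be permuted by [z.2]. *)
pose z0 : 'I_d * {set X} := (ord0, set0).
pose b F (l : X) := nth z0 (enum (tagged_factors F)) (enum_rank l).
pose label (z : {ffun 'I_d -> {set {set X}}} * {perm X}) :=
  ([ffun l => (b z.1 (z.2 l)).2], [ffun l => (b z.1 (z.2 l)).1]).
have size_tagged F : F \in tuples -> size (enum (tagged_factors F)) = #|X|.
  by rewrite inE => /forallP F1; rewrite -cardE card_tagged_factors.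
have b_in (F : {ffun 'I_d -> {set {set X}}}) l :
  F \in tuples -> b F l \in tagged_factors F.
  by move=> TF; rewrite -mem_enum mem_nth // size_tagged.
have b_inj F : F \in tuples -> injective (b F).
  move=> TF l l' /eqP; rewrite nth_uniq ?enum_uniq ?size_tagged //.
  by move/eqP/val_inj/enum_rank_inj.
have b_surj F z : F \in tuples -> z \in tagged_factors F -> exists l, b F l = z.
  move=> TF Fz; have := Fz; rewrite -mem_enum -index_mem size_tagged // => lt_z.
  exists (enum_val (Ordinal lt_z)); rewrite /b enum_valK /=.
  by rewrite nth_index // mem_enum.
have memF F s z : F \in tuples -> (z \in tagged_factors F) =
    [exists l, (((label (F, s)).2 l, (label (F, s)).1 l) == z)].
  move=> TF; apply/idP/existsP => [Fz|[l /eqP<-]].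
    have [l bl] := b_surj F z TF Fz; exists ((s^-1)%g l).
    by rewrite !ffunE /= permKV bl -surjective_pairing.
  by rewrite !ffunE /= -surjective_pairing b_in.
rewrite -(@card_in_imset _ _ label); last first.
  move=> [F s] [F' s'] /setXP[TF _] /setXP[TF' _] eq_label.
  have eqF : F = F'.
    apply/ffunP => j; apply/setP => e.
    have := memF F s (j, e) TF; have := memF F' s' (j, e) TF'.
    by rewrite eq_label !inE /= => -> ->.
  case: _ / eqF in TF' eq_label *; congr (_, _); apply/permP => l.
  apply: (b_inj F TF); case: eq_label => /ffunP/(_ l) + /ffunP/(_ l).
  rewrite !ffunE /=.
  by case: (b F (s l)) (b F (s' l)) => [? ?] [? ?] /= -> ->.
apply: subset_leq_card; apply/subsetP => _ /imsetP[[F s] /setXP[TF _] ->].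
have F1 j : is_factor1 W (F j) by move: TF; rewrite inE => /forallP; apply.
rewrite inE; apply/andP; split.
  rewrite inE; apply/forallP => l; rewrite ffunE /=.
  have := b_in F (s l) TF; rewrite inE; apply: subsetP.
  by have /andP[] := F1 (b F (s l)).1.
rewrite inE; apply/forallP => v; apply/forallP => j.
have /andP[_ /forallP/(_ v)/cards1P[e eE]] := F1 j.
have e_in : (e \in F j) && (v \in e) by have := set11 e; rewrite -eE inE.
have /(b_surj F _ TF)[l bl] : (j, e) \in tagged_factors F.
  by rewrite inE; case/andP: e_in.
apply/cards1P; exists ((s^-1)%g l); apply/setP => x; rewrite !inE !ffunE /=.
apply/andP/eqP => [[/eqP xj vx]|->]; last first.
  by rewrite permKV bl /=; case/andP: e_in.
apply: (canRL (permK s)); apply: (b_inj F TF); rewrite bl.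
have : (b F (s x)).2 \in [set e].
  by rewrite -eE inE vx andbT -xj; have := b_in F (s x) TF; rewrite inE.
by rewrite inE; move: xj; case: (b F (s x)) => [? ?] /= -> /eqP ->.
Qed.

End DoubleCounting.

Section Permanent.
Variables (X : finType) (n d' : nat) (x : 'I_n -> X) (W : {set {set X}}).
Local Notation d := d'.+1.
Hypothesis x_bij : bijective x.

Definition supported_diagonals : {set {ffun 'I_d' -> {perm 'I_n}}} :=
  [set sigma : {ffun 'I_d' -> {perm 'I_n}} | [forall i,
    [set x k | k in [tuple of i :: [tuple sigma j i | j < d']]] \in W]].

Lemma per_adjacencyE (R : comPzRingType) :
  per (adjacency R d x W) = #|supported_diagonals|%:R.
Proof.
rewrite /= -sum1_card natr_sum [RHS]big_mkcond /=; apply: eq_bigr => sigma _.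
rewrite inE; case: ifPn => [/forallP sW|].
  by apply: big1 => i _; rewrite /adjacency sW.
rewrite negb_forall => /existsP[i /negPf iW].
by rewrite (bigD1 i) //= /adjacency iW mul0r.
Qed.

(** Relabelling the edges by their vertex in first position turns the orderings
    of a labelled hypergraph into a nonzero diagonal of the adjacency matrix
    and one permutation, the relabelling. *)
Lemma perm_tuples_le :
  (\sum_(h in labellings X W) #|perm_tuples X d h|
     <= #|{perm X}| * #|supported_diagonals|)%N.
Proof.
have [y xK yK] := x_bij.
pose good := [set p : {ffun 'I_d -> {perm X}} |
  [forall l, [set p j l | j : 'I_d] \in W]].
apply: (@leq_trans #|good|).
  rewrite -[#|good|]sum1_card.
  pose edges (p : {ffun 'I_d -> {perm X}}) := [ffun l => [set p j l | j : 'I_d]].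
  rewrite (partition_big edges (mem (labellings X W))) => [|p]; last first.
    rewrite !inE => /forallP pW; apply/forallP => l; rewrite ffunE; exact: pW.
  apply: leq_sum => h Lh; rewrite sum1dep_card; apply: subset_leq_card.
  apply/subsetP => p; rewrite !inE => /forallP ph; apply/andP; split.
    apply/forallP => l; rewrite -(eqP (ph l)).
    by move: Lh; rewrite inE => /forallP.
  by apply/eqP/ffunP => l; rewrite ffunE (eqP (ph l)).
rewrite -cardsT -cardsX.
pose move (p : {ffun 'I_d -> {perm X}}) (j : 'I_d') i :=
  y (p (lift ord0 j) ((p ord0)^-1%g (x i))).
have move_inj p j : injective (move p j).
  move=> i i' /(can_inj yK)/perm_inj/perm_inj; exact: can_inj xK _ _.
pose split (p : {ffun 'I_d -> {perm X}}) :=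
  (p ord0, [ffun j => perm (move_inj p j)]).
have splitE p j l : x ((split p).2 j (y (p ord0 l))) = p (lift ord0 j) l.
  by rewrite ffunE permE /move !yK permK.
have split_inj : injective split.
  move=> p q eq_pq; apply/ffunP => j; apply/permP => l.
  have eq0 : p ord0 = q ord0 := congr1 fst eq_pq.
  case: (unliftP ord0 j) => [j' ->|->]; last by rewrite eq0.
  by rewrite -!splitE eq_pq eq0.
rewrite -(card_imset _ split_inj); apply: subset_leq_card.
apply/subsetP => _ /imsetP[p + ->]; rewrite !inE => /forallP pW /=.
apply/forallP => i; have := pW ((p ord0)^-1%g (x i)).
congr (_ \in W); apply/setP => v; apply/imsetP/imsetP.
  case=> j _ ->; case: (unliftP ord0 j) => [j' ->|->].
    exists (perm (move_inj p j') i); last by rewrite permE /move yK.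
    rewrite inE; apply/orP; right; apply/mapP; exists j'; rewrite ?mem_enum //.
    by rewrite ffunE.
  by exists i; rewrite ?permKV // mem_head.
case=> k; rewrite inE => /orP[/eqP->|/mapP[j _ ->]] ->.
  by exists ord0; rewrite ?permKV.
by exists (lift ord0 j); rewrite // ffunE permE /move yK.
Qed.

End Permanent.

(** * The constants *)

Section Bases.
Variable R : realType.

(** [rho_of d] bounds the [s]-th roots of [s!] for [s < d], while its [d]-th power
    need only be at least [d! * gurvits d].  For [d = 2] and [d = 3] the gain over
    the [d]-th root of [d!] explains the special values of [mu].  For [d >= 4]
    the factor [gurvits d] is given up. *)
Definition rho_of (d : nat) : R :=
  match d with
  | 2 => 1
  | 3 => 2 `^ (1 / 2)
  | _ => d`!%:R `^ (1 / d%:R)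
  end.

Lemma powR_root_expn (a : R) k : (0 < k)%N -> 0 <= a -> (a `^ (1 / k%:R)) ^+ k = a.
Proof.
move=> k_gt0 a_ge0; rewrite -powR_mulrn ?powR_ge0 // -powRrM divfK ?powRr1 //.
by rewrite pnatr_eq0 -lt0n.
Qed.

Lemma rho_gt0 d : 0 < rho_of d.
Proof.
by case: d => [|[|[|[|d]]]]; rewrite /rho_of // powR_gt0 // ltr0n ?fact_gt0.
Qed.

(** The [s]-th root of [s!] increases with [s]. *)
Lemma fact_exp_le s d : (s <= d)%N -> (s`! ^ d <= d`! ^ s)%N.
Proof.
elim: d => [|d IH]; first by rewrite leqn0 => /eqP->.
rewrite leq_eqVlt => /orP[/eqP->//|]; rewrite ltnS => le_sd.
rewrite expnS factS expnMn leq_mul ?IH //.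
have : (s`! <= s ^ s)%N.
  elim: (s) => // m IHm; rewrite factS expnS leq_mul // (leq_trans IHm) //.
  by case: m {IHm} => // m; rewrite leq_exp2r.
move/leq_trans; apply; case: (posnP s) => [-> //|s_gt0].
by rewrite leq_exp2r // leqW.
Qed.

Lemma fact_le_rho_of d s : (2 <= d)%N -> (s < d)%N -> s`!%:R <= rho_of d ^+ s.
Proof.
move=> d_ge2 s_lt; case: d => [|[|[|[|d]]]] // in d_ge2 s_lt *.
- by case: s s_lt => [|[|]] //; rewrite expr1n.
- case: s s_lt => [|[|[|]]] // _.
    rewrite expr1 /= -[X in X <= _](_ : 1 `^ (1 / 2) = 1 :> R); last by rewrite powR1.
    by apply: ge0_ler_powR; rewrite ?nnegrE // ?divr_ge0 // ler1n.
  by rewrite /rho_of powR_root_expn.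
rewrite /rho_of; set D := d.+4; set r := _ `^ _.
have r_ge0 : 0 <= r := powR_ge0 _ _.
rewrite -(@ler_pXn2r _ D) ?nnegrE ?exprn_ge0 //.
rewrite exprAC powR_root_expn // -!natrX ler_nat.
exact/fact_exp_le/ltnW.
Qed.

Lemma fact_gurvits_le_rho_of d : (2 <= d)%N ->
  d`!%:R * gurvits R d <= rho_of d ^+ d.
Proof.
case: d => [|[|[|[|d]]]] // _.
- by rewrite /gurvits /rho_of /= expr1n expr1 (_ : 2`! = 2)%N //; lra.
- rewrite /gurvits /rho_of /=; set r := 2 `^ _.
  have r2 : r ^+ 2 = 2 by rewrite powR_root_expn.
  have r_ge0 : 0 <= r := powR_ge0 _ _.
  rewrite (_ : 3`! = 6)%N // (exprS r 2) r2.
  have r43 : 4 / 3 <= r.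
    rewrite -(@ler_pXn2r _ 2) ?nnegrE ?divr_ge0 // r2; lra.
  lra.
rewrite /rho_of powR_root_expn //.
by rewrite ler_piMr ?gurvits_le1.
Qed.

Lemma muE n d : (2 <= d)%N ->
  mu R n d = (\prod_(j < d) gurvits_growth R j.+1 / rho_of d) ^+ n.
Proof.
move=> d_ge2; rewrite prod_gurvits_growth.
case: d d_ge2 => [|[|[|[|d]]]] // _.
- rewrite /mu /rho_of divr1 (_ : _ / _ = 1) ?expr1n //.
  by rewrite (_ : 2`! = 2)%N // divff // expf_neq0 // pnatr_eq0.
- rewrite /mu /rho_of; congr (_ ^+ n); set r := 2 `^ (1 / 2).
  have r_neq0 : r != 0 :> R by rewrite gt_eqF // powR_gt0.
  have r2 : r ^+ 2 = 2 by rewrite powR_root_expn.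
  have -> : 2 `^ (3 / 2) = r ^+ 3 :> R.
    by rewrite -powR_mulrn ?powR_ge0 // -powRrM; congr (_ `^ _); field.
  have -> : r^-1 = r / 2.
    by apply: (mulfI r_neq0); rewrite mulfV // mulrA -expr2 r2 divff // pnatr_eq0.
  by rewrite (exprS r 2) r2 (_ : 3`! = 6)%N //; field.
by rewrite /mu /rho_of invfM mulrA.
Qed.

End Bases.

Theorem theorem4 (R : realType) (d n : nat) (X : finType) (x : 'I_n -> X)
    (W : {set {set X}}) (d_ge2 : (2 <= d)%N) (d_dvd_n : (d %| n)%N)
    (x_bij : bijective x) (W_uniform : uniform d W) :
  (num_factor1 W)%:R <=
    (per (adjacency R d x W) / mu R n d) `^ (1 / d%:R).
Proof.
have cardX : #|X| = n by rewrite -(bij_eq_card x_bij) card_ord.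
case: d => [//|d'] in d_ge2 d_dvd_n W_uniform *.
set d := d'.+1 in d_ge2 *.
rewrite per_adjacencyE muE //; set M := _ ^+ n.
have M_gt0 : 0 < M.
  rewrite exprn_gt0 // divr_gt0 ?rho_gt0 // prodr_gt0 // => j _.
  by rewrite mulr_gt0 ?gurvits_gt0 ?ltr0n.
have le_each h : h \in labellings X W ->
    #|factor_colorings X d' h|%:R * M <= #|perm_tuples X d h|%:R.
  rewrite inE => /forallP hW; rewrite /M -cardX.
  apply: factor_colorings_le; rewrite ?rho_gt0 //.
  - by move=> l; apply/eqP; apply: (implyP (forallP W_uniform (h l))).
  - by move=> s; apply: fact_le_rho_of.
  - exact: fact_gurvits_le_rho_of.
have perm_gt0 : 0 < #|{perm X}|%:R :> R.
  by rewrite ltr0n; apply/card_gt0P; exists 1%g.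
have le_pow : (num_factor1 W)%:R ^+ d <= #|supported_diagonals X n d' x W|%:R / M :> R.
  rewrite ler_pdivlMr // -(ler_pM2l perm_gt0) mulrA -natrX -!natrM.
  have := factor_tuples_le X W d' W_uniform.
  rewrite -(ler_nat R) => /(ler_wpM2r (ltW M_gt0)) /le_trans; apply.
  have := perm_tuples_le X n d' x W x_bij.
  rewrite -(ler_nat R); apply: le_trans.
  by rewrite !natr_sum mulr_suml; apply: ler_sum.
have -> : (num_factor1 W)%:R = ((num_factor1 W)%:R ^+ d) `^ (1 / d%:R) :> R.
  by rewrite -powR_mulrn // -powRrM mulrC divfK ?powRr1 // pnatr_eq0.
apply: ge0_ler_powR; rewrite ?nnegrE //; first by rewrite divr_ge0.
  exact: exprn_ge0.
by rewrite divr_ge0 // (ltW M_gt0).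
Qed.
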